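(* Let $D\subset\mathbf{R}^2$, let $f:D\to\mathbf{R}$ be a function, let $P_0=(x_0,y_0)\in\mathbf{R}^2$ be an accumulation point of $D$, and let $L$ be a real constant. Suppose there exists a punctured neighborhood $U_0(P_0,\rho)=\{P\in\mathbf{R}^2: 0<|P-P_0|<\rho\}$, $\rho>0$, such that the set $(U_0(P_0,\rho)\cap D)\cup\{P_0\}$ is convex. Then $\lim_{P\to P_0,\,P\in D} f(P)=L$ if and only if the following condition holds: for every constant $\phi_0\in[0,2\pi]$ and every real-valued function $\phi(r)$, defined for $r\in(0,\delta)$ with some $\delta>0$ and satisfying $\lim_{r\to0}\phi(r)=\phi_0$, such that the path $P(r)=(x_0+r\cos\phi(r),\;y_0+r\sin\phi(r))$ is contained in $D$, one has $\lim_{r\to0} f(P(r))=L$.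
   Context: The limit $\lim_{P\to P_0,\,P\in D} f(P)=L$ means: $P_0$ is an accumulation point of $D$ and for every $\varepsilon>0$ there is a punctured neighborhood $U_0(P_0,r)=\{P\in\mathbf{R}^2: 0<|P-P_0|<r\}$, $r>0$, such that $|f(P)-L|<\varepsilon$ for all $P\in U_0(P_0,r)\cap D$. In the condition, ''path'' means just the family of points $P(r)$ determined by the function $\phi$; no continuity of $\phi$ is required. *)

(* Defs.v *)
From HB Require Import structures.
From mathcomp Require Import all_boot all_order all_algebra.
From mathcomp Require Import all_classical all_reals all_analysis.

Set Implicit Arguments.
Unset Strict Implicit.
Unset Printing Implicit Defensive.

Import Order.TTheory GRing.Theory Num.Theory.
Import numFieldNormedType.Exports.

Local Open Scope classical_set_scope.
Local Open Scope ring_scope.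

(* The library norm on [R * R] is the max norm, hence a separate Euclidean
   norm; both induce the same topology. *)
Definition eucl_norm (R : realType) (P : R * R) : R :=
  Num.sqrt (P.1 ^+ 2 + P.2 ^+ 2).

Definition punctured_disc (R : realType) (P0 : R * R) (r : R) : set (R * R) :=
  [set P | 0 < eucl_norm (P - P0) < r].

(* A function on [D] is represented by a total function whose values outside
   [D] are never used. *)
Definition limit_on (R : realType) (D : set (R * R)) (f : R * R -> R)
    (P0 : R * R) (L : R) : Prop :=
  limit_point D P0 /\
  forall eps : R, 0 < eps ->
    exists2 r : R, 0 < r &
      forall P, (punctured_disc P0 r `&` D) P -> `|f P - L| < eps.

Definition polar_path (R : realType) (P0 : R * R) (phi : R -> R) (r : R)
    : R * R :=
  (P0.1 + r * cos (phi r), P0.2 + r * sin (phi r)).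

(* [phi] matters only on ]0, delta[: a limit as r tends to 0 of a function
   defined on that interval is a limit along the filter [0^'+]. *)
Definition polar_path_condition (R : realType) (D : set (R * R))
    (f : R * R -> R) (P0 : R * R) (L : R) : Prop :=
  forall (phi0 : R) (phi : R -> R) (delta : R),
    0 <= phi0 <= 2 * pi ->
    0 < delta ->
    phi r @[r --> 0^'+] --> phi0 ->
    (forall r, 0 < r < delta -> D (polar_path P0 phi r)) ->
    f (polar_path P0 phi r) @[r --> 0^'+] --> L.

(* Main.v *)
Require Import Defs.
From HB Require Import structures.
From mathcomp Require Import all_boot all_order all_algebra.
From mathcomp Require Import all_classical all_reals all_analysis.
From mathcomp Require Import ring lra.

(* The converse is by contraposition. If the limit is not L, there are bad points
   of D, where |f - L| >= eps, arbitrarily close to P0; by compactness of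
   [0, 2 pi] their polar angles accumulate at some t0, so there are bad points
   (s_n, t_n) with s_n decreasing to 0 and t_n tending to t0. Convexity is only
   used to know that D contains the radial segment from each bad point to P0
   (excluded), so the path that follows the direction t_n for s_(n+1) < r <= s_n
   stays in D; its angle tends to t0, yet it meets every bad point (s_n, t_n). *)

Set Implicit Arguments.
Unset Strict Implicit.
Unset Printing Implicit Defensive.

Import Order.TTheory GRing.Theory Num.Theory.
Import numFieldNormedType.Exports.

Local Open Scope classical_set_scope.
Local Open Scope ring_scope.

Section PolarPath.
Variable R : realType.
Implicit Types (D : set (R * R)) (P Q : R * R) (r s t : R).

Lemma eucl_norm_polar P (phi : R -> R) r :
  0 <= r -> eucl_norm (polar_path P phi r - P) = r.
Proof.
move=> r0; rewrite /eucl_norm /polar_path /=.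
rewrite [X in X ^+ 2 + _]addrC [X in _ + X ^+ 2]addrC !addKr.
by rewrite !exprMn -mulrDr cos2Dsin2 mulr1 sqrtr_sqr ger0_norm.
Qed.

(** [acos] only yields angles in [0, pi], so a negative second coordinate of [Q - P] calls for the
    reflected angle 2 pi - [acos x]. *)
Lemma polar_pathP P Q : 0 < eucl_norm (Q - P) ->
  exists2 t, 0 <= t <= 2 * pi & Q = polar_path P (cst t) (eucl_norm (Q - P)).
Proof.
case: P Q => [a b] [c d]; set s := eucl_norm _ => s0.
have s2 : s ^+ 2 = (c - a) ^+ 2 + (d - b) ^+ 2.
  by rewrite sqr_sqrtr // addr_ge0 ?sqr_ge0.
pose x := (c - a) / s; pose y := (d - b) / s.
have xs : s * x = c - a by rewrite /x; field; exact: lt0r_neq0.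
have ys : s * y = d - b by rewrite /y; field; exact: lt0r_neq0.
have xy : x ^+ 2 + y ^+ 2 = 1.
  by rewrite !expr_div_n -mulrDl -s2 divff // expf_neq0 // lt0r_neq0.
have x1 : -1 <= x <= 1.
  rewrite -ler_norml -(@ler_pXn2r _ 2) ?nnegrE // expr1n.
  by rewrite real_normK ?num_real // -xy lerDl sqr_ge0.
have y2 : 1 - x ^+ 2 = y ^+ 2 by rewrite -xy addrC addKr.
have t0 := acos_ge0 x1; have tpi := acos_lepi x1.
have cost : cos (acos x) = x by rewrite acosK // in_itv.
have sint : sin (acos x) = `|y| by rewrite sin_acos // y2 sqrtr_sqr.
have pi0 := pi_ge0 R.
have [y0|y0] := leP 0 y.
  exists (acos x); first by lra.
  by rewrite /polar_path /= cost sint ger0_norm // xs ys !subrKC.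
exists (pi *+ 2 - acos x); first by lra.
rewrite /polar_path /= cosB sinB cos2pi sin2pi cost sint ltr0_norm //.
by rewrite !mul0r !mul1r addr0 sub0r opprK xs ys !subrKC.
Qed.

(** The point at radius [r] is the convex combination of the point at radius [s] and [P] with
    weights r / s and 1 - r / s. *)
Lemma polar_path_star D P rho t s r :
  convex_set ((punctured_disc P rho `&` D) `|` [set P]) ->
  0 < r <= s -> s < rho ->
  D (polar_path P (cst t) s) -> D (polar_path P (cst t) r).
Proof.
move=> /convex_setW cvx /andP[r0 rs] srho Ds.
have s0 : 0 < s by exact: lt_le_trans rs.
have [->//|rNs] := eqVneq r s.
have {rNs}rs : r < s by rewrite lt_neqAle rNs.
have l0 : 0 < r / s by rewrite divr_gt0.
have l1 : r / s < 1 by rewrite ltr_pdivrMr // mul1r.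
have Es : polar_path P (cst t) s \in (punctured_disc P rho `&` D) `|` [set P].
  rewrite inE; left; split=> //.
  by rewrite /punctured_disc /= eucl_norm_polar ?s0 ?ltW.
have EP : P \in (punctured_disc P rho `&` D) `|` [set P] by rewrite inE; right.
have := cvx _ _ Es EP (Itv01 (ltW l0) (ltW l1)) l0 l1.
have -> : conv (Itv01 (ltW l0) (ltW l1))
    (polar_path P (cst t) s : convex_lmodType _) P = polar_path P (cst t) r.
  rewrite /conv /= /polar_path /=; case: P {cvx Ds Es EP} => a b.
  by congr pair; rewrite /= /unstable.onem /GRing.scale /=; field; exact: lt0r_neq0.
(* The combination could only escape [D] by being [P] itself, but its distance to [P] is [r], which
   is positive. *)
rewrite inE => -[[]//|/= rP].
have := eucl_norm_polar P (cst t) (ltW r0); rewrite rP subrr /eucl_norm /=.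
by rewrite expr0n addr0 sqrtr0 => r00; rewrite -r00 ltxx in r0.
Qed.

(** The sets of angles in [a, b] realised in [B] at radii below [r] form a base of a proper filter,
    which clusters at some [t0] by compactness. *)
Lemma small_radius_cluster (B : R -> R -> Prop) (a b : R) :
  (forall r, 0 < r -> exists s t, [/\ 0 < s < r, a <= t <= b & B s t]) ->
  exists2 t0, a <= t0 <= b &
    forall e, 0 < e -> exists s t, [/\ 0 < s < e, `|t - t0| < e & B s t].
Proof.
move=> Bsmall.
pose A r := [set t | a <= t <= b /\ exists2 s, 0 < s < r & B s t].
pose F := filter_from [set r : R | 0 < r] A.
have FF : ProperFilter F.
  apply: filter_from_proper; last first.
    move=> r /Bsmall[s [t [sr tab Bst]]]; exists t; split=> //; by exists s.
  apply: filter_from_filter; first by exists 1; rewrite /= ltr01.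
  move=> r1 r2 /= r10 r20; exists (Num.min r1 r2); first by rewrite /= lt_min r10.
  move=> t [tab [s]]; rewrite lt_min => /and3P[s0 s1 s2] Bst.
  by split; split=> //; exists s; rewrite ?s0.
have [|t0 [t0ab clt0]] := segment_compact (a := a) (b := b) FF.
  by exists 1 => [|t [tab _]]; rewrite /= ?ltr01 // in_itv.
exists t0; first by move: t0ab; rewrite /= in_itv.
move=> e e0.
have [|t [[_ [s se Bst]] tt0]] := clt0 (A e) (ball t0 e) _ (nbhsx_ballx _ _ e0).
  by exists e.
by exists s, t; split=> //; rewrite distrC.
Qed.

(* The pairs (s_n, t_n) in [B] are chosen with s_(n+1) < s_n / 2 and
   |t_(n+1) - t0| < s_n, and phi is constantly t_n on ]s_(n+1), s_n]. *)
Lemma step_path (B : R -> R -> Prop) (t0 : R) :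
  (forall e, 0 < e -> exists s t, [/\ 0 < s < e, `|t - t0| < e & B s t]) ->
  exists (phi : R -> R) (delta : R),
    [/\ 0 < delta,
        phi r @[r --> 0^'+] --> t0,
        forall r, 0 < r < delta -> exists2 s, r <= s & B s (phi r) &
        forall d, 0 < d -> exists2 r, 0 < r < d & B r (phi r)].
Proof.
move=> Bt0.
(* The bound [e / 2] will force the iterated radii to 0; (0, 0) is a default value for [e <= 0]. *)
have /choice[c cP] : forall e, exists st : R * R, 0 < e ->
    [/\ 0 < st.1 < e / 2, `|st.2 - t0| < e & B st.1 st.2].
  move=> e; have [e0|_] := ltP 0 e; last by exists (0, 0).
  have [|s [t [/andP[s0 se] tt0 Bst]]] := Bt0 (e / 2); first by rewrite divr_gt0.
  exists (s, t) => _; split => //=; first by rewrite s0.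
  by lra.
pose b n := iter n (fun st : R * R => c st.1) (c 1).
have b0 n : 0 < (b n).1.
  by elim: n => [|n IH] /=; [have [/andP[]] := cP _ ltr01|have [/andP[]] := cP _ IH].
have bS n : (b n.+1).1 < (b n).1 / 2 by have [/andP[]] := cP _ (b0 n).
have bt n : `|(b n.+1).2 - t0| < (b n).1 by have [] := cP _ (b0 n).
have Bb n : B (b n).1 (b n).2.
  by case: n => [|n]; [have [] := cP _ ltr01|have [] := cP _ (b0 n)].
have bdecr m n : (m <= n)%N -> (b n).1 <= (b m).1.
  elim: n => [|n IH]; first by rewrite leqn0 => /eqP->.
  rewrite leq_eqVlt => /predU1P[->//|/IH]; apply: le_trans.
  by have := bS n; have := b0 n; lra.
have bsmall e : 0 < e -> exists n, (b n).1 < e.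
  move=> e0.
  (* This crude consequence of halving, based on n + 2 <= 2 (n + 1), is enough for the radii to tend
     to 0. *)
  have bn n : (b n).1 * n.+1%:R <= 1.
    elim: n => [|n IH]; first by rewrite mulr1; have [/andP[_ +] _ _] := cP _ ltr01; rewrite /b /=; lra.
    have n0 := ler0n R n; have yn := mulr_ge0 (ltW (b0 n.+1)) n0.
    have xy : 0 <= (n%:R + 1) * ((b n).1 - 2 * (b n.+1).1).
      by apply: mulr_ge0; [lra|have := bS n; lra].
    move: IH; rewrite -!natr1; lra.
  have [n] := ltr_add_invr e0; rewrite add0r => ne; exists n.
  by apply: le_lt_trans ne; rewrite -[X in _ <= X]mul1r ler_pdivlMr ?ltr0n.
(* [N r] will be the least such [n], so that s_(n+1) < r <= s_n whenever 0 < r <= s_0. *)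
have Nex r : exists n, (0 < r) ==> ((b n.+1).1 < r).
  have [r0|r0] := ltP 0 r; last by exists 0%N.
  have [n nr] := bsmall _ r0; exists n.
  by apply: le_lt_trans nr; exact: bdecr.
pose N r := ex_minn (Nex r).
have Nlt r : 0 < r -> (b (N r).+1).1 < r.
  by move=> r0; rewrite /N; case: ex_minnP => n /implyP/(_ r0).
have Nmin r n : (b n.+1).1 < r -> (N r <= n)%N.
  by move=> nr; rewrite /N; case: ex_minnP => m _; apply; apply/implyP.
have Nge r : 0 < r -> r <= (b 0%N).1 -> r <= (b (N r)).1.
  move=> r0 r1; case E : (N r) => [//|n].
  by rewrite leNgt; apply/negP => /Nmin; rewrite E ltnn.
(* As the intervals are closed on the right, radius s_n keeps its own angle t_n. *)
have Nb n : N (b n).1 = n.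
  apply/eqP; rewrite eqn_leq; apply/andP; split.
    by apply: Nmin; have := bS n; have := b0 n; lra.
  rewrite leqNgt; apply/negP => /bdecr; apply/negP; rewrite -ltNge.
  exact: Nlt.
exists (fun r => (b (N r)).2), (b 0%N).1; split => //.
- apply/cvgrPdist_lt => e e0; have [n ne] := bsmall _ e0.
  near=> r.
  have r0 : 0 < r by [].
  have rn : r < (b n.+1).1 by near: r; apply: nbhs_right_lt.
  (* Hence [N r] = m + 1 with n <= m, and |t_(m+1) - t0| < s_m <= s_n < e. *)
  have : (n < N r)%N.
    rewrite ltnNge; apply/negP => Nn.
    have := bdecr (N r).+1 n.+1 Nn; have := Nlt r r0; lra.
  case: (N r) => // m nm; rewrite distrC; apply: lt_trans (bt m) _.
  by apply: le_lt_trans ne; exact: bdecr.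
- move=> r /andP[r0 r1]; exists (b (N r)).1 => //.
  by apply: Nge => //; exact: ltW.
- move=> d d0; have [n nd] := bsmall _ d0.
  by exists (b n).1; rewrite ?b0 ?Nb.
Unshelve. all: by end_near.
Qed.
End PolarPath.

Theorem theorem2 (R : realType) (D : set (R * R)) (f : R * R -> R)
    (P0 : R * R) (L : R)
    (hacc : limit_point D P0)
    (hconv : exists2 rho : R, 0 < rho &
       convex_set ((punctured_disc P0 rho `&` D) `|` [set P0])) :
  limit_on D f P0 L <-> polar_path_condition D f P0 L.
Proof.
split=> [[_ flim] t0 phi delta _ delta0 _ Dphi|fpath].
  apply/cvgrPdist_lt => e /flim[d d0 fd]; near=> r.
  have r0 : 0 < r by [].
  rewrite distrC; apply: fd; split.
    rewrite /punctured_disc /= eucl_norm_polar ?ltW // r0 /=.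
    by near: r; exact: nbhs_right_lt.
  by apply: Dphi; rewrite r0; near: r; exact: nbhs_right_lt.
split=> // e e0; case: hconv => rho rho0 cvx.
apply: contrapT => flim.
pose B s t := [/\ s < rho, D (polar_path P0 (cst t) s) &
  e <= `|f (polar_path P0 (cst t) s) - L|].
have Bsmall d : 0 < d ->
    exists s t, [/\ 0 < s < d, 0 <= t <= 2 * pi & B s t].
  move=> d0; apply: contrapT => nB; apply: flim.
  (* Without bad points at radii below both [d] and [rho], this radius would witness the limit for
     [e]. *)
  exists (Num.min d rho); first by rewrite lt_min d0.
  move=> Q [/= /andP[Q0 Qd] DQ]; rewrite ltNge; apply/negP => fQ; apply: nB.
  have [t tpi QE] := polar_pathP Q0.
  move: Qd; rewrite lt_min => /andP[Qd Qrho].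
  by exists (eucl_norm (Q - P0)), t; rewrite Q0 Qd /B -QE.
have [t0 t0pi Bt0] := small_radius_cluster Bsmall.
have [phi [delta [delta0 phit0 phiB Bphi]]] := step_path Bt0.
have /cvgrPdist_lt/(_ e e0)[d /= d0 fd] :
    f (polar_path P0 phi r) @[r --> 0^'+] --> L.
  (* The path point at radius [r] lies between [P0] and a bad point at radius [s >= r] in the same
     direction [phi r]. *)
  apply: (fpath t0 phi delta) => // r /[dup] /andP[r0 _] /phiB[s rs [srho Ds _]].
  by apply: (polar_path_star cvx _ srho Ds); rewrite r0.
have [r /andP[r0 rd] [_ _]] := Bphi d d0.
apply/negP; rewrite -ltNge distrC; apply: fd => //=.
by rewrite sub0r normrN gtr0_norm.
Unshelve. all: by end_near.
Qed.
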